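(* Let $q\ge1$ be an integer. Any graph $G=(V,E,\ell)$ with a set $T\subset V$ of $k$ terminals admits a $(2q-1,\ \mathcal{O}(k^{2+2/q}))$-DAM, where the constant hidden in $\mathcal{O}(\cdot)$ is absolute (independent of $G$, $T$, $k$ and $q$).
   Context: Graphs $G=(V,E,\ell)$ are finite and undirected, with an edge length function $\ell:E\to\mathbb{R}^+$ and a designated set $T\subset V$ of $k$ vertices called terminals; the other vertices are non-terminals. $d_G$ is the shortest-path distance. A minor of $G$ is a graph obtained by a sequence of vertex deletions, edge deletions and edge contractions, where no terminal may be deleted and no two terminals may be contracted together (so every terminal survives; a super-node containing terminal $t$ is identified with $t$); a minor carries its own edge length function $\ell'$. A minor $H=(V',E',\ell')$ of $G$ is an $\alpha$-distance approximating minor ($\alpha$-DAM) of $G$ if $d_G(t,t')\le d_H(t,t')\le\alpha\cdot d_G(t,t')$ for all $t,t'\in T$. It is an $(\alpha,y)$-DAM if in addition it has at most $y$ non-terminals. *)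

(* Defs.v *)
From HB Require Import structures.
From mathcomp Require Import all_boot all_order all_algebra.
From mathcomp Require Import all_classical all_reals all_analysis.
Set Implicit Arguments.
Unset Strict Implicit.
Unset Printing Implicit Defensive.
Import Order.TTheory GRing.Theory Num.Theory.
Local Open Scope ring_scope.

Definition wf_edges (V : finType) (A : {set V}) (E : {set {set V}}) : bool :=
  [forall e in E, (e \subset A) && (#|e| == 2)%N].

(* Vertices range over a subset of an ambient finite type, so that the minor
   operations below stay within one type. An edge is a two-element set. *)
Record graph (V : finType) := Graph {
  vertices : {set V};
  edges : {set {set V}};
  edgesP : wf_edges vertices edges }.

Section MinorOperations.
Variables (V : finType) (G : graph V).

Lemma del_vertex_subproof (v : V) :
  wf_edges (vertices G :\ v) [set e in edges G | v \notin e].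
Proof.
apply/forall_inP => e; rewrite inE => /andP[eG ve].
have /andP[eA e2] := forall_inP (edgesP G) e eG.
by rewrite e2 andbT subsetD1 eA ve.
Qed.

Definition del_vertex (v : V) : graph V := Graph (del_vertex_subproof v).

Lemma del_edge_subproof (e : {set V}) : wf_edges (vertices G) (edges G :\ e).
Proof.
apply/forall_inP => f; rewrite in_setD1 => /andP[_ fG].
exact: (forall_inP (edgesP G) f fG).
Qed.

Definition del_edge (e : {set V}) : graph V := Graph (del_edge_subproof e).

Definition redirect (u v x : V) : V := if x == v then u else x.

(* [u |: _] is [vertices G :\ v] whenever [[set u; v]] is an edge. *)
Lemma contract_subproof (u v : V) :
  wf_edges (u |: (vertices G :\ v))
    [set f in [set redirect u v @: e | e : {set V} in edges G] | #|f| == 2%N].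
Proof.
apply/forall_inP => f; rewrite inE => /andP[/imsetP[e eG ->] ->].
rewrite andbT; apply/fintype.subsetP => _ /imsetP[x xe ->].
have /andP[/fintype.subsetP eA _] := forall_inP (edgesP G) e eG.
rewrite /redirect !inE; case: (eqVneq x v) => [_|xv]; first by rewrite eqxx.
by rewrite xv eA ?orbT.
Qed.

(* Merges [v] into [u], the super-node being named [u]; the loop is dropped and
   parallel edges are identified. *)
Definition contract (u v : V) : graph V := Graph (contract_subproof u v).

End MinorOperations.

(* In [minor_contract] the absorbed endpoint is a non-terminal: hence two
   terminals are never merged, and a super-node containing a terminal keeps the
   name of that terminal. *)
Inductive minor (V : finType) (T : {set V}) (G : graph V) : graph V -> Prop :=
| minor_refl : minor T G G
| minor_del_vertex (H : graph V) (v : V) :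
    minor T G H -> v \in vertices H -> v \notin T ->
    minor T G (del_vertex H v)
| minor_del_edge (H : graph V) (e : {set V}) :
    minor T G H -> e \in edges H -> minor T G (del_edge H e)
| minor_contract (H : graph V) (u v : V) :
    minor T G H -> [set u; v]%SET \in edges H -> v \notin T ->
    minor T G (contract H u v).

(* A length function is total on [{set V}]; only its values on edges matter. *)
Definition positive_on_edges (R : realType) (V : finType) (G : graph V)
    (len : {set V} -> R) : Prop :=
  forall e : {set V}, e \in edges G -> 0 < len e.

Definition adj (V : finType) (G : graph V) : rel V :=
  fun x y => [set x; y]%SET \in edges G.

Definition is_path (V : finType) (G : graph V) (s t : V) (p : seq V) : Prop :=
  [&& s \in vertices G, path (adj G) s p, uniq (s :: p) & last s p == t].

Definition path_length (R : realType) (V : finType) (len : {set V} -> R)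
    (s : V) (p : seq V) : R :=
  \sum_(e <- pairmap (fun x y => [set x; y]%SET) s p) len e.

(* The infimum is over finitely many paths, hence is attained if there is one;
   it is [+oo] if [s] and [t] are not connected in [G]. *)
Definition dist (R : realType) (V : finType) (G : graph V)
    (len : {set V} -> R) (s t : V) : \bar R :=
  ereal_inf [set (path_length len s p)%:E | p in is_path G s t]%classic.

Definition is_DAM (R : realType) (V : finType) (T : {set V})
    (G : graph V) (len : {set V} -> R) (alpha : R)
    (H : graph V) (len' : {set V} -> R) : Prop :=
  [/\ minor T G H,
      positive_on_edges H len' &
      forall t t' : V, t \in T -> t' \in T ->
        (dist G len t t' <= dist H len' t t' /\
         dist H len' t t' <= alpha%:E * dist G len t t')%E].

Definition is_DAM_size (R : realType) (V : finType) (T : {set V})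
    (G : graph V) (len : {set V} -> R) (alpha y : R)
    (H : graph V) (len' : {set V} -> R) : Prop :=
  is_DAM T G len alpha H len' /\ #|vertices H :\: T|%:R <= y.

(* Main.v *)
(* A greedy (2q-1)-spanner of the terminal metric has girth above 2q, hence at
   most 2 k^(1+1/q) edges. Among the minors of G that keep the exact distance
   of every spanner pair, edges being weighted by the G-distance of their
   endpoints, take a smallest one. For a non-terminal v in it, minimality under
   deletions and contractions provides an edge e at v and two spanner pairs
   such that e is unavoidable for the first, while the geodesic chosen for the
   second goes through v but not along e. A given couple of spanner pairs
   arises in this way from at most two non-terminals, so their number is at
   most quadratic in the size of the spanner. *)
Require Import Defs.
From HB Require Import structures.
From mathcomp Require Import all_boot all_order all_algebra.
From mathcomp Require Import all_classical all_reals all_analysis.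
From mathcomp Require Import ring lra.
Set Implicit Arguments.
Unset Strict Implicit.
Unset Printing Implicit Defensive.
Import Order.TTheory GRing.Theory Num.Theory.
Local Open Scope ring_scope.

(** * Girth and the number of edges *)

Section HopBalls.
Variable V : finType.
Implicit Types (r : rel V) (x y z : V) (n i j : nat).

Fixpoint hop_ball r x n : {set V} :=
  if n is m.+1 then
    hop_ball r x m :|: [set y | [exists z in hop_ball r x m, r z y]]
  else [set x].

Lemma hop_ball_step r x y z n :
  y \in hop_ball r x n -> r y z -> z \in hop_ball r x n.+1.
Proof.
move=> yn ryz /=; rewrite finset.in_setU [X in _ || X]inE.
by apply/orP; right; apply/exists_inP; exists y.
Qed.

Lemma hop_ballS r x n y : y \in hop_ball r x n -> y \in hop_ball r x n.+1.
Proof. by move=> yn /=; rewrite finset.in_setU yn. Qed.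

Lemma hop_ball_leq r x m n y :
  (m <= n)%N -> y \in hop_ball r x m -> y \in hop_ball r x n.
Proof.
by move/subnK <-; elim: (n - m)%N => // k IH /IH; exact: hop_ballS.
Qed.

Lemma hop_ballSP r x n z : z \in hop_ball r x n.+1 ->
  z \in hop_ball r x n \/ exists2 y, y \in hop_ball r x n & r y z.
Proof.
rewrite /= finset.in_setU [X in _ || X]inE => /orP[|/exists_inP[y]];
  first by left.
by move=> yn ryz; right; exists y.
Qed.

Lemma hop_ball_center r x n : x \in hop_ball r x n.
Proof. by apply: (@hop_ball_leq _ _ 0) => //; rewrite inE. Qed.

Lemma hop_ball_trans r x y z i j :
  y \in hop_ball r x i -> z \in hop_ball r y j -> z \in hop_ball r x (i + j).
Proof.
move=> yi; elim: j z => [|j IH] z; first by rewrite inE addn0 => /eqP->.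
rewrite addnS => /hop_ballSP[/IH/hop_ballS //|[w /IH wi rwz]].
exact: hop_ball_step rwz.
Qed.

Lemma hop_ball_sym r x y n : symmetric r ->
  y \in hop_ball r x n -> x \in hop_ball r y n.
Proof.
move=> rs; elim: n y => [|n IH] y; first by rewrite !inE eq_sym.
case/hop_ballSP => [/IH/hop_ballS //|[z /IH xz rzy]].
rewrite -add1n; apply: hop_ball_trans xz.
by apply: (@hop_ball_step _ _ y); rewrite ?inE // rs.
Qed.

Lemma sub_hop_ball r r' x n : subrel r r' ->
  {subset hop_ball r x n <= hop_ball r' x n}.
Proof.
move=> sr; elim: n => // n IH y /hop_ballSP[/IH/hop_ballS //|[z /IH xz /sr]].
exact: hop_ball_step.
Qed.

Definition rm_edge r (a b : V) : rel V :=
  fun u v => r u v && ([set u; v]%SET != [set a; b]%SET).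

Definition rm_vertex r (v : V) : rel V := fun x y =>
  [&& r x y, x != v & y != v].

(* Every cycle has more than [2 q] edges. *)
Definition hop_free q r :=
  forall a b, r a b -> b \notin hop_ball (rm_edge r a b) a (2 * q).-1.

Lemma symmetric_rm_vertex r v : symmetric r -> symmetric (rm_vertex r v).
Proof. by move=> rs x y; rewrite /rm_vertex rs [(x != v) && _]andbC. Qed.

Lemma hop_free_sub q r r' : subrel r r' -> hop_free q r' -> hop_free q r.
Proof.
move=> sr hf a b rab; apply: contra (hf _ _ (sr _ _ rab)).
by apply: sub_hop_ball => u v /andP[/sr ruv nuv]; rewrite /rm_edge ruv.
Qed.

(** Since [y] is at hop distance at least [i] from [x], a walk of at most [i] hops can meet [y] only
    at its end; one that ends elsewhere survives the removal of [y]. *)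
Lemma hop_ball_rm_vertex r x y i a :
  (forall j, (j < i)%N -> y \notin hop_ball r x j) -> a != y ->
  a \in hop_ball r x i -> a \in hop_ball (rm_vertex r y) x i.
Proof.
elim: i a => [|i IH] a yfar ay; first by rewrite !inE.
have yfar' j : (j < i)%N -> y \notin hop_ball r x j.
  by move=> ji; apply: yfar; rewrite ltnS ltnW.
case/hop_ballSP => [ai|[z zi rza]]; first exact/hop_ballS/IH.
have zy : z != y by apply: contraNneq (yfar i (ltnSn i)) => <-.
by apply: (hop_ball_step (IH _ yfar' zy zi)); rewrite /rm_vertex rza zy ay.
Qed.

(* Two such neighbours would close a cycle through [x] of at most [2 i + 2]
   edges. *)
Lemma hop_free_unique_nbr q r x y a b i : symmetric r -> hop_free q r ->
  (i < q)%N -> (forall j, (j < i)%N -> y \notin hop_ball r x j) ->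
  r y a -> r y b -> a != y -> b != y ->
  a \in hop_ball r x i -> b \in hop_ball r x i -> a = b.
Proof.
move=> rs hf iq yfar rya ryb ay byn ai bi; apply/eqP; apply: contraT => ab.
have ray : r a y by rewrite rs.
have sub : subrel (rm_vertex r y) (rm_edge r a y).
  move=> u v /and3P[ruv uy vy]; rewrite /rm_edge ruv /=.
  apply/eqP => /setP/(_ y); rewrite !inE eqxx orbT.
  by rewrite ![y == _]eq_sym (negPf uy) (negPf vy).
have symv := symmetric_rm_vertex y rs.
have ax := hop_ball_sym symv (hop_ball_rm_vertex yfar ay ai).
have ab' := hop_ball_trans ax (hop_ball_rm_vertex yfar byn bi).
have yb : y \in hop_ball (rm_edge r a y) a (i + i).+1.
  apply: (hop_ball_step (sub_hop_ball sub ab')).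
  rewrite /rm_edge rs ryb /=; apply/eqP => /setP/(_ b).
  by rewrite !inE eqxx [b == a]eq_sym (negPf ab) (negPf byn).
(* The cycle has [2 i + 2 <= 2 q] edges; without the edge [a y] itself, at most [(2 q).-1] hops
   remain. *)
have := hf _ _ ray; rewrite (hop_ball_leq _ yb) //.
rewrite addnn -mul2n; have : ((2 * i).+2 <= 2 * q)%N.
  by rewrite -[(2 * i).+2]/(2 + 2 * i)%N -mulnS leq_mul2l.
by case: (2 * q)%N.
Qed.

Definition hop_sphere r x n : {set V} :=
  if n is m.+1 then hop_ball r x m.+1 :\: hop_ball r x m else [set x].

Lemma hop_sphere_sub r x n : hop_sphere r x n \subset hop_ball r x n.
Proof. by case: n => [|n] //=; apply: finset.subsetDl. Qed.

Lemma hop_sphere_far r x n j y : y \in hop_sphere r x n -> (j < n)%N ->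
  y \notin hop_ball r x j.
Proof.
case: n => // n /=; rewrite finset.in_setD => /andP[yn _]; rewrite ltnS => jn.
exact: contra (hop_ball_leq jn) yn.
Qed.

(** Double counting of the edges between consecutive spheres. A point [y] of the inner sphere has at
    most one neighbour in the ball of radius [n], so at least [d] of its neighbours lie in the outer
    sphere. A point of the outer sphere has at most one neighbour in the inner one. *)
Lemma hop_sphere_growth q r x n d : symmetric r -> irreflexive r ->
  hop_free q r -> (n < q)%N ->
  (forall y, y \in hop_sphere r x n -> (d < #|[set z | r y z]|)%N) ->
  (d * #|hop_sphere r x n| <= #|hop_sphere r x n.+1|)%N.
Proof.
move=> rs ri hf nq degd.
have neq u v : r u v -> v != u.
  by move=> ruv; apply: contraTneq ruv => ->; rewrite ri.
pose N y := [set z in hop_sphere r x n.+1 | r y z].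
have Nd y : y \in hop_sphere r x n -> (d <= #|N y|)%N.
  move=> yn; have yb := fintype.subsetP (hop_sphere_sub r x n) y yn.
  have split : [set z | r y z] = N y :|: [set z in hop_ball r x n | r y z].
    apply/setP => z; rewrite !inE; case ryz: (r y z); rewrite ?andbF ?andbT //=.
    have := hop_ball_step yb ryz => /=; rewrite !inE => ->; rewrite andbT.
    by case: (z \in hop_ball _ _ _).
  have small : (#|[set z in hop_ball r x n | r y z]| <= 1)%N.
    apply/card_le1_eqP => a b; rewrite !inE => /andP[an rya] /andP[bn ryb].
    apply: (@hop_free_unique_nbr q r x y b a n) => //; try exact: neq.
    by move=> j; apply: hop_sphere_far.
  have := degd y yn; rewrite split => lt.
  have := leq_trans lt (finset.leq_card_setU _ _) => lt2.
  by rewrite -(leq_add2r 1) addn1 (leq_trans lt2) // leq_add2l.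
rewrite mulnC -sum_nat_const.
apply: (@leq_trans (\sum_(y in hop_sphere r x n) #|N y|)).
  by apply: leq_sum => y; apply: Nd.
have cardN y : #|N y| = (\sum_(z in hop_sphere r x n.+1) r y z)%N.
  rewrite -sum1_card (eq_bigl (fun z => (z \in hop_sphere r x n.+1) && r y z)).
    by rewrite big_mkcondr; apply: eq_bigr => z _; case: (r y z).
  by move=> z; rewrite inE.
under eq_bigr => y _ do rewrite cardN.
rewrite exchange_big -sum1_card; apply: leq_sum => z zS.
have -> : (\sum_(y in hop_sphere r x n) r y z)%N =
    #|[set y in hop_sphere r x n | r y z]|.
  rewrite -sum1_card [RHS](eq_bigl (fun y =>
    (y \in hop_sphere r x n) && r y z)).
    by rewrite [RHS]big_mkcondr; apply: eq_bigr => y _; case: (r y z).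
  by move=> y; rewrite inE.
apply/card_le1_eqP => a b; rewrite !inE => /andP[an raz] /andP[bn rbz].
have rza : r z a by rewrite rs.
have rzb : r z b by rewrite rs.
apply: (@hop_free_unique_nbr q r x z b a n) => //; try exact: neq.
- by move=> j jn; apply: hop_sphere_far zS _; rewrite ltnS ltnW.
- exact: fintype.subsetP (hop_sphere_sub r x n) _ bn.
- exact: fintype.subsetP (hop_sphere_sub r x n) _ an.
Qed.

(** If all degrees exceeded [d], the spheres around a point of [A] would grow by a factor [d] up to
    radius [q], and the last one would not fit into [A]. *)
Lemma hop_free_low_degree q r (A : {set V}) d : symmetric r -> irreflexive r ->
  hop_free q r -> (forall x y, r x y -> y \in A) -> A != finset.set0 ->
  (#|A| < d ^ q)%N -> exists2 x, x \in A & (#|[set z | r x z]| <= d)%N.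
Proof.
move=> rs ri hf rA /set0Pn[x xA] Ad.
apply/exists_inP; apply: contraT => /exists_inPn deg.
have ballA n : hop_ball r x n \subset A.
  apply/fintype.subsetP; elim: n => [|n IH] y; first by rewrite inE => /eqP->.
  by case/hop_ballSP => [/IH //|[z _ /rA]].
have grow n : (n <= q)%N -> (d ^ n <= #|hop_sphere r x n|)%N.
  elim: n => [|n IH] nq; first by rewrite cards1.
  rewrite expnS; apply: leq_trans (hop_sphere_growth (d := d) rs ri hf nq _).
    by rewrite leq_mul2l IH ?orbT // ltnW.
  move=> y yn; rewrite ltnNge; apply: deg.
  exact: fintype.subsetP (ballA n) _ (fintype.subsetP (hop_sphere_sub r x n) _
    yn).
have := grow q (leqnn q); rewrite leqNgt (leq_ltn_trans _ Ad) //.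
exact/subset_leq_card/(fintype.subset_trans (hop_sphere_sub r x q)).
Qed.

Definition edge_rel (E : {set {set V}}) : rel V := fun x y => [set x;
  y]%SET \in E.

Lemma symmetric_edge_rel E : symmetric (edge_rel E).
Proof. by move=> x y; rewrite /edge_rel finset.setUC. Qed.

Lemma irreflexive_edge_rel (A : {set V}) E : wf_edges A E -> irreflexive
  (edge_rel E).
Proof.
move=> /forall_inP wf x; apply/negP => /wf/andP[_].
by rewrite finset.setUid cards1.
Qed.

(* The minimum degree of every subgraph is at most [d], so the edges can be
   counted by removing vertices one at a time. *)
Lemma hop_free_card_edges q d (A : {set V}) E : wf_edges A E -> hop_free q
  (edge_rel E) ->
  (#|A| < d ^ q)%N -> (#|E| <= d * #|A|)%N.
Proof.
move En: #|A| => n; elim: n A E En => [|n IH] A E An wf hf nd.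
  have A0 : A = finset.set0 by apply/eqP; rewrite -cards_eq0 An.
  rewrite muln0 leqn0 cards_eq0; apply/eqP/setP => e; rewrite inE.
  apply/negP => /(forall_inP wf)/andP[].
  by rewrite A0 finset.subset0 => /eqP ->; rewrite cards0.
have A0 : A != finset.set0 by rewrite -cards_eq0 An.
have EA x y : edge_rel E x y -> y \in A.
  move=> /(forall_inP wf)/andP[/fintype.subsetP sub _].
  by apply: sub; rewrite !inE eqxx orbT.
have Ad : (#|A| < d ^ q)%N by rewrite An.
have [x xA degx] := hop_free_low_degree (symmetric_edge_rel E)
  (irreflexive_edge_rel wf) hf EA A0 Ad.
pose E1 := [set e in E | x \notin e].
have E1E : E1 \subset E by apply/fintype.subsetP => e; rewrite inE => /andP[].
have cardA : #|A :\ x| = n by have := cardsD1 x A; rewrite xA An => -[].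
have wf1 : wf_edges (A :\ x) E1.
  apply/forall_inP => e; rewrite inE => /andP[eE xe].
  have /andP[eA e2] := forall_inP wf e eE.
  by rewrite e2 andbT subsetD1 eA xe.
have hf1 : hop_free q (edge_rel E1).
  by apply: hop_free_sub hf => u v; apply: (fintype.subsetP E1E).
have := IH _ _ cardA wf1 hf1 (ltn_trans (ltnSn n) nd) => le1.
(* The edges lost with [x] are indexed by the neighbours of [x], so there are at most [d] of
   them. *)
have incl : E \subset E1 :|: [set [set x;
  z]%SET | z in [set z | edge_rel E x z]].
  apply/fintype.subsetP => e eE; rewrite !inE eE /=.
  case: (boolP (x \in e)) => //= xe.
  have /andP[_ /cards2P[a [b [ab Ee]]]] := forall_inP wf e eE.
  move: xe; rewrite Ee !inE => /orP[/eqP xa|/eqP xb]; apply/imsetP.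
    by exists b; rewrite ?xa // inE /edge_rel -Ee.
  by exists a; rewrite ?inE /edge_rel xb finset.setUC -?Ee.
rewrite mulnS; apply: leq_trans (subset_leq_card incl) _.
apply: leq_trans (finset.leq_card_setU _ _) _; rewrite addnC leq_add //.
exact: leq_trans (leq_imset_card _ _) degx.
Qed.

End HopBalls.

(** * Greedy spanners *)

Lemma set2_eq (V : finType) (a b s t : V) : [set a; b]%SET = [set s; t]%SET ->
  (a = s /\ b = t) \/ (a = t /\ b = s).
Proof.
move=> /setP eq; have := eq a; have := eq b; have := eq s; have := eq t.
rewrite !inE !eqxx ?orbT.
move=> t1 s1 /esym/orP b1 /esym/orP[/eqP a1|/eqP a1]; subst a.
  case: b1 => /eqP b1; subst b; last by left.
  by move: t1; rewrite orbb => /eqP ->; left.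
case: b1 => /eqP b1; subst b; first by right.
by move: s1; rewrite orbb => /eqP ->; right.
Qed.

Section GreedySpanner.
Variables (V : finType) (q : nat).
Implicit Types (r : rel V) (E : {set {set V}}) (s t x y : V).

Definition add_edge r s t : rel V :=
  fun u v => r u v || ([set u; v]%SET == [set s; t]%SET).

(** A short walk needs the new edge at most once. If it uses it, the hops before and after that use
    number [i] and [j], and the use itself makes the inequality strict. *)
Lemma hop_ball_add_edge r s t x y n : y \in hop_ball (add_edge r s t) x n ->
  y \in hop_ball r x n \/
  exists i j, (i + j < n)%N /\
    ((s \in hop_ball r x i /\ y \in hop_ball r t j) \/
     (t \in hop_ball r x i /\ y \in hop_ball r s j)).
Proof.
elim: n y => [|n IH] y; first by left.
case/hop_ballSP => [/IH|[z /IH zn /orP rzy]].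
  case=> [/hop_ballS|[i [j [ij H]]]]; first by left.
  by right; exists i, j; split; first exact: ltnW.
case: zn => [zn|[i [j [ij H]]]].
  case: rzy => [rzy|/eqP/set2_eq[] [zs yt]]; first by left;
    apply: hop_ball_step rzy.
  - right; exists n, 0%N; rewrite addn0 ltnSn; split => //.
    by left; rewrite -zs yt; split=> //; apply: hop_ball_center.
  - right; exists n, 0%N; rewrite addn0 ltnSn; split => //.
    by right; rewrite -zs yt; split=> //; apply: hop_ball_center.
have ltS : (i < n.+1)%N by rewrite ltnS (leq_trans (leq_addr j i)) // ltnW.
case: rzy => [rzy|/eqP/set2_eq[] [zs yt]].
- right; exists i, j.+1; rewrite addnS ltnS; split => //.
  by case: H => -[H1 H2]; [left|right]; split=> //; apply: hop_ball_step rzy.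
(* Here [y] is an end of the new edge: either it was reached before the first use of that edge, or
   that use already arrives at [y]. The second use is dropped. *)
- case: H => -[H1 H2]; last by left; rewrite yt; apply: hop_ball_leq H1;
    apply: ltnW.
  right; exists i, 0%N; rewrite addn0; split => //.
  by left; split=> //; rewrite yt hop_ball_center.
- case: H => -[H1 H2]; first by left; rewrite yt; apply: hop_ball_leq H1;
    apply: ltnW.
  right; exists i, 0%N; rewrite addn0; split => //.
  by right; split=> //; rewrite yt hop_ball_center.
Qed.

(** A new short cycle contains [s t]. If it is detected at another edge [a b], its remaining arcs
    run from [a] and [b] to the two ends of [s t]; joined by [a b], they connect [s] to [t] in [E]
    within [(2 q).-1] hops. *)
Lemma hop_free_add_edge E s t : hop_free q (edge_rel E) ->
  t \notin hop_ball (edge_rel E) s (2 * q).-1 ->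
  hop_free q (edge_rel ([set s; t]%SET |: E)).
Proof.
move=> hf far a b; set E' := _ |: E => abE'.
have sym := symmetric_edge_rel E.
have [abst|abst] := eqVneq [set a; b]%SET [set s; t]%SET.
  have sub : subrel (rm_edge (edge_rel E') a b) (edge_rel E).
    by move=> u v /andP[]; rewrite /edge_rel !inE -abst => /orP[->|].
  apply: contra far => /(sub_hop_ball sub) bN.
  case/set2_eq: abst => -[<- <-] //.
  exact: hop_ball_sym.
have abE : edge_rel E a b by move: abE'; rewrite /edge_rel !inE (negPf abst).
have baE : edge_rel E b a by rewrite sym.
have sub1 : subrel (rm_edge (edge_rel E) a b) (edge_rel E).
  by move=> u v /andP[].
have sub : subrel (rm_edge (edge_rel E') a b)
                  (add_edge (rm_edge (edge_rel E) a b) s t).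
  move=> u v /andP[]; rewrite /edge_rel /add_edge /rm_edge !inE.
  by case/orP => [->|-> ->] //; rewrite orbT.
apply/negP => /(sub_hop_ball sub)/hop_ball_add_edge[bN|].
  by have := hf _ _ abE; rewrite bN.
case=> i [j [ij H]]; move/negP: far; apply; apply: hop_ball_leq ij _.
case: H => -[/(sub_hop_ball sub1) ai /(sub_hop_ball sub1) bj].
  have ba := hop_ball_step (hop_ball_sym sym ai) abE.
  by have := hop_ball_trans ba (hop_ball_sym sym bj); rewrite addSn.
have ab := hop_ball_step bj baE.
by have := hop_ball_trans ab ai; rewrite addSn addnC.
Qed.

(** The greedy algorithm scans [l] by nondecreasing weight and adds a pair unless its ends are
    already within [(2 q).-1] hops. Stretch is expressed by hops along edges no heavier than the
    pair, so that it transfers to any metric in which these edges are short. *)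
Lemma greedy_spanner (R : realType) (w : V -> V -> R) (l : seq (V * V)) :
  (0 < q)%N -> (forall x y, w x y = w y x) ->
  pairwise (fun a b => w a.1 a.2 <= w b.1 b.2) l ->
  exists E, [/\ forall e, e \in E -> exists2 a, a \in l & e = [set a.1;
    a.2]%SET,
    hop_free q (edge_rel E) &
    forall a, a \in l ->
      a.2 \in hop_ball (fun u v => edge_rel E u v && (w u v <= w a.1 a.2))
                a.1 (2 * q).-1].
Proof.
move=> q0 wC; elim/last_ind: l => [_|l [s t] IH].
  by exists finset.set0; split=> [e|a b|a] //; rewrite ?inE // /edge_rel inE.
rewrite pairwise_rcons => /andP[/allP /= lel /IH[E [El hf span]]].
(* As [l] is sorted, every edge selected so far is at most as heavy as the current pair. *)
have wE u v : edge_rel E u v -> w u v <= w s t.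
  case/El=> -[a b] /lel /= lab /set2_eq[] [-> ->] //.
  by rewrite wC.
(* At least one hop is allowed, so a pair that is added spans itself. *)
have N0 : (0 < (2 * q).-1)%N by case: q q0 => // n _; rewrite mulnS.
have [near|far] := boolP (t \in hop_ball (edge_rel E) s (2 * q).-1).
  exists E; split=> // [e /El[a al ->]|a].
    by exists a; rewrite // mem_rcons inE al orbT.
  rewrite mem_rcons inE => /predU1P[->/=|/span //].
  by apply: sub_hop_ball near => u v uv; rewrite uv wE.
exists ([set s; t]%SET |: E); split=> [e||a].
- rewrite !inE => /predU1P[->|/El[a al ->]].
    by exists (s, t); rewrite // mem_rcons mem_head.
  by exists a; rewrite // mem_rcons inE al orbT.
- exact: hop_free_add_edge.
rewrite mem_rcons inE => /predU1P[->/=|/span].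
  apply: (hop_ball_leq N0); apply: hop_ball_step (hop_ball_center _ s 0) _.
  by rewrite /edge_rel !inE eqxx lexx.
apply: sub_hop_ball => u v /andP[uv ->].
by rewrite andbT /edge_rel !inE [_ \in E]uv orbT.
Qed.

End GreedySpanner.

(** * Walks and distances *)

Section Walks.
Variables (R : realType) (V : finType).
Implicit Types (G : graph V) (len : {set V} -> R) (s t u v x y : V) (p : seq V).

(** Vertices may repeat, unlike in [is_path], which makes walks closed under concatenation and
    rerouting. *)
Definition walk G s t p : bool :=
  [&& s \in vertices G, path (adj G) s p & last s p == t].

Definition walk_edges s p : seq {set V} :=
  pairmap (fun x y => [set x; y]%SET) s p.

Lemma adj_sym G : symmetric (adj G).
Proof. by move=> x y; rewrite /adj finset.setUC. Qed.

Lemma adj_neq G x y : adj G x y -> x != y.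
Proof.
move=> /(forall_inP (edgesP G))/andP[_].
by apply: contraTneq => ->; rewrite finset.setUid cards1.
Qed.

Lemma adj_vertex G x y : adj G x y -> x \in vertices G.
Proof.
move=> /(forall_inP (edgesP G))/andP[/fintype.subsetP sub _].
by apply: sub; rewrite !inE eqxx.
Qed.

Lemma path_length_cons len s x p :
  path_length len s (x :: p) = len [set s; x]%SET + path_length len x p.
Proof. by rewrite /path_length /= big_cons. Qed.

Lemma path_length_cat len s p1 p2 :
  path_length len s (p1 ++ p2) =
  path_length len s p1 + path_length len (last s p1) p2.
Proof. by rewrite /path_length pairmap_cat big_cat. Qed.

Lemma walk_edges_cat s p1 p2 :
  walk_edges s (p1 ++ p2) = walk_edges s p1 ++ walk_edges (last s p1) p2.
Proof. exact: pairmap_cat. Qed.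

Lemma path_adjE G s p :
  path (adj G) s p = all (fun e => e \in edges G) (walk_edges s p).
Proof. by elim: p s => //= x p IH s; rewrite IH. Qed.

Lemma mem_walk_edges s p e x : e \in walk_edges s p -> x \in e -> x \in s :: p.
Proof.
elim: p s => //= y p IH s; rewrite inE => /predU1P[->|ep xe].
  by rewrite !inE => /orP[->|->]; rewrite ?orbT.
by rewrite in_cons (IH _ ep xe) orbT.
Qed.

Lemma walk_edges_rev s p :
  walk_edges (last s p) (rev (belast s p)) = rev (walk_edges s p).
Proof.
elim: p s => //= x p IH s; rewrite !rev_cons -!cats1 walk_edges_cat IH /=.
congr (_ ++ [:: _]); rewrite finset.setUC; congr ([set _; _]%SET).
by case: p {IH} => //= y p; rewrite rev_cons last_rcons.
Qed.

Lemma walk_cat G s t u p1 p2 : walk G s t p1 -> walk G t u p2 ->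
  walk G s u (p1 ++ p2).
Proof.
move=> /and3P[sG p1P /eqP <-] /and3P[_ p2P /eqP <-].
by rewrite /walk sG cat_path p1P p2P last_cat /=.
Qed.

Lemma walk_split G s t p1 p2 : walk G s t (p1 ++ p2) ->
  walk G s (last s p1) p1 /\ walk G (last s p1) t p2.
Proof.
move=> /and3P[sG]; rewrite cat_path last_cat => /andP[P1 P2] lt.
split; first by rewrite /walk sG P1 eqxx.
rewrite /walk P2 lt !andbT; elim: p1 s sG P1 {P2 lt} => //= x p1 IH s _.
by move=> /andP[sx]; apply: IH; apply: (@adj_vertex _ _ s); rewrite adj_sym.
Qed.

Lemma walk_end G s t p : walk G s t p -> t \in vertices G.
Proof.
move=> wp; have := wp; rewrite -[p]cats0 => /walk_split[_].
by case/and3P: wp => _ _ /eqP -> /and3P[].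
Qed.

Lemma walk_rev G len s t p : walk G s t p ->
  exists p', [/\ walk G t s p', path_length len t p' = path_length len s p &
                 walk_edges t p' =i walk_edges s p].
Proof.
move=> wp; have tG := walk_end wp; case/and3P: wp => sG pP /eqP lt; subst t.
exists (rev (belast s p)); rewrite /path_length; split.
- rewrite /walk tG path_adjE walk_edges_rev all_rev -path_adjE pP /=.
  by case: p {pP tG} => //= y p; rewrite rev_cons last_rcons.
- rewrite -[pairmap _ _ _]/(walk_edges _ _) walk_edges_rev.
  by apply: perm_big; rewrite perm_rev.
- by move=> e; rewrite walk_edges_rev mem_rev.
Qed.

Lemma is_path_walk G s t p : is_path G s t p -> walk G s t p.
Proof. by case/and4P=> sG pP _ lt; rewrite /walk sG pP lt. Qed.

Lemma path_length_ge0 G len s p : positive_on_edges G len ->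
  path (adj G) s p -> 0 <= path_length len s p.
Proof.
move=> pos; elim: p s => [|x p IH] s; first by rewrite /path_length big_nil.
by move=> /= /andP[/pos/ltW sx /IH xp]; rewrite path_length_cons addr_ge0.
Qed.

(** Closed subwalks are cut out; lengths being positive, this does not increase the total. *)
Lemma walk_to_path G len s t p : positive_on_edges G len -> walk G s t p ->
  exists2 p', is_path G s t p' & path_length len s p' <= path_length len s p.
Proof.
move=> pos; elim: p s => [|x p IH] s /and3P[sG pP lt].
  by exists [::]; rewrite /is_path ?sG.
case/andP: pP => sx pP; have xG : x \in vertices G.
  by apply: (@adj_vertex _ _ s); rewrite adj_sym.
have [|p' /and4P[_ pP' Up' lt'] le] := IH x; first by apply/and3P.
have [sp|sp] := boolP (s \in x :: p'); last first.
  exists (x :: p').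
    by apply/and4P; split=> //; [rewrite /= sx | rewrite cons_uniq sp].
  by rewrite !path_length_cons lerD2l.
case/splitPl: sp pP' Up' lt' le => p1 p2 ls.
rewrite cat_path last_cat ls -cat_cons => /andP[pP1 pP2] Up lt' le.
exists p2.
  rewrite /is_path sG pP2 lt' andbT /=.
  move: Up; rewrite lastI cat_rcons ls cat_uniq.
  by case/and3P.
rewrite path_length_cons (le_trans _ (lerD (ltW (pos _ sx)) le)) //.
by rewrite add0r path_length_cat ls lerDr (path_length_ge0 pos).
Qed.

Lemma dist_le_walk G len s t p : positive_on_edges G len -> walk G s t p ->
  (dist G len s t <= (path_length len s p)%:E)%E.
Proof.
move=> pos /(walk_to_path pos)[p' p'P le].
by apply: ge_ereal_inf; exists (path_length len s p')%:E => //; exists p'.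
Qed.

Lemma dist_attained G len s t : (dist G len s t < +oo)%E ->
  exists2 p, is_path G s t p & dist G len s t = (path_length len s p)%:E.
Proof.
have [[p0 p0P] _|none] := pselect (exists p, is_path G s t p); last first.
  have E0 : [set (path_length len s p)%:E | p in is_path G s t]%classic = set0.
    by rewrite -subset0 => y [p pP _]; case: none; exists p.
  by rewrite /dist E0 ereal_inf0 ltxx.
(* A simple path fits into a sequence of length at most [#|V|]. Such sequences form a finite type,
   on which a minimum exists. *)
have bnd p : is_path G s t p -> (size p <= #|V|)%N.
  case/and4P=> _ _ /card_uniqP /= Up _; apply: ltnW.
  by rewrite -Up; apply: max_card.
pose P (p : {bseq #|V| of V}) :=
  [&& s \in vertices G, path (adj G) s p, uniq (s :: p) & last s p == t].
have P0 : P (Bseq (bnd _ p0P)) by exact: p0P.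
case: (@arg_minP _ R _ (Bseq (bnd _ p0P)) P
  (fun p : {bseq #|V| of V} => path_length len s p) P0) => p pP pmin.
exists (p : seq V) => //; apply/eqP; rewrite eq_le; apply/andP; split.
  by apply: ge_ereal_inf; exists (path_length len s p)%:E => //;
    exists (p : seq V).
apply: le_ereal_inf_tmp => _ [p' p'P <-]; rewrite lee_fin.
exact: (pmin (Bseq (bnd _ p'P))).
Qed.

End Walks.

Section Distances.
Variables (R : realType) (V : finType) (G : graph V) (len : {set V} -> R).
Hypothesis pos : positive_on_edges G len.
Implicit Types (s t u : V).

Lemma dist_ge0 s t : (0 <= dist G len s t)%E.
Proof.
apply: le_ereal_inf_tmp => _ [p /and4P[_ pP _ _] <-]; rewrite lee_fin.
exact: path_length_ge0 pos pP.
Qed.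

Lemma dist_self s : s \in vertices G -> dist G len s s = 0%E.
Proof.
move=> sG; apply/eqP; rewrite eq_le dist_ge0 andbT.
have /(dist_le_walk pos) : walk G s s [::] by rewrite /walk sG /=.
by rewrite /path_length big_nil.
Qed.

Lemma dist_sym s t : dist G len s t = dist G len t s.
Proof.
suff le a b : (dist G len a b <= dist G len b a)%E.
  by apply/eqP; rewrite eq_le !le.
apply: le_ereal_inf_tmp => _ [p /is_path_walk/(walk_rev len)[p' [wp' <- _]] <-].
exact: dist_le_walk pos wp'.
Qed.

Lemma dist_triangle s t u :
  (dist G len s u <= dist G len s t + dist G len t u)%E.
Proof.
(* If a summand is [+oo], so is the sum, because the other one is not [-oo]. *)
have [/eqP st|] := boolP (dist G len s t == +oo)%E.
  by rewrite st addye ?leey // gt_eqF // (lt_le_trans _ (dist_ge0 _ _)) ?ltNy0.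
have [/eqP tu _|] := boolP (dist G len t u == +oo)%E.
  by rewrite tu addey ?leey // gt_eqF // (lt_le_trans _ (dist_ge0 _ _)) ?ltNy0.
rewrite -!ltey => /dist_attained[p2 /is_path_walk w2 ->].
move=> /dist_attained[p1 /is_path_walk w1 ->].
have := dist_le_walk pos (walk_cat w1 w2).
by rewrite path_length_cat; case/and3P: w1 => _ _ /eqP ->.
Qed.

Lemma dist_finite_vertices s t : (dist G len s t < +oo)%E ->
  s \in vertices G /\ t \in vertices G.
Proof.
move=> /dist_attained[p /is_path_walk wp _].
by split; [case/and3P: wp | exact: walk_end wp].
Qed.

Lemma dist_gt0 s t : (dist G len s t < +oo)%E -> s != t ->
  (0 < dist G len s t)%E.
Proof.
move=> /dist_attained[[|x p] /and4P[_ pP _ lt] ->] st.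
  by rewrite -(eqP lt) eqxx in st.
case/andP: pP => /pos sx /(path_length_ge0 pos) xp.
by rewrite lte_fin path_length_cons ltr_wpDr.
Qed.

Lemma dist_fineK s t : (dist G len s t < +oo)%E ->
  (fine (dist G len s t))%:E = dist G len s t.
Proof. by move=> fin; rewrite fineK // ge0_fin_numE ?dist_ge0. Qed.

End Distances.

Lemma subseq_cons_split (A : eqType) (x : A) (l p : seq A) :
  subseq (x :: l) p -> exists p1 p2, p = p1 ++ x :: p2 /\ subseq l p2.
Proof.
elim: p => //= y p IH; case: eqVneq => [<-|_]; first by exists [::], p.
by case/IH => p1 [p2 [-> lp2]]; exists (y :: p1), p2.
Qed.

Lemma uniq_mid (A : eqType) (l1 l2 : seq A) (x : A) :
  uniq (l1 ++ x :: l2) -> x \notin l1 /\ x \notin l2.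
Proof.
by rewrite cat_uniq /= negb_or => /and3P[_ /andP[-> _] /andP[-> _]].
Qed.

(** * Branching of geodesics *)

Section Geodesics.
Variables (R : realType) (V : finType) (H : graph V) (len : {set V} -> R).
Implicit Types (s t a b : V) (p w : seq V).

(** [sg] is the piece of [p] between [a] and [b], reversed if [b] comes first. The walk [w] is [p]
    with this piece exchanged for [tau], possibly reversed. *)
Lemma walk_segment s t p a b : walk H s t p -> a \in s :: p -> b \in s :: p ->
  exists sg, [/\ walk H a b sg,
    {subset walk_edges a sg <= walk_edges s p} &
    forall tau, walk H a b tau -> exists2 w, walk H s t w &
      path_length len s w + path_length len a sg =
      path_length len s p + path_length len a tau].
Proof.
move=> wp ap bp.
have [p1 [p2 [p3 [Ep ab]]]] : exists p1 p2 p3, p = p1 ++ p2 ++ p3 /\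
   ((last s p1 = a /\ last a p2 = b) \/ (last s p1 = b /\ last b p2 = a)).
  case/splitPl: ap bp {wp} => p1 p2 l1.
  rewrite -cat_cons mem_cat => /orP[bp1|bp2].
    move: l1; case/splitPl: bp1 => q1 q2 l2; rewrite last_cat l2 => l1.
    by exists q1, q2, p2; rewrite catA; split=> //; right.
  have bp : b \in a :: p2 by rewrite inE bp2 orbT.
  by case/splitPl: bp => q1 q2 l2; exists p1, q1, q2; split=> //; left.
move: wp; rewrite Ep => /walk_split[w1 /walk_split[w2 w3]].
case: ab => -[l1 l2]; rewrite l1 l2 in w1 w2 w3.
  exists p2; split=> // [e ep|tau wt].
    by rewrite !walk_edges_cat l1 !mem_cat ep orbT.
  exists (p1 ++ tau ++ p3); first exact: walk_cat w1 (walk_cat wt w3).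
  have /and3P[_ _ /eqP lt] := wt.
  by rewrite !path_length_cat l1 l2 lt; lra.
have [sg [wsg lsg esg]] := walk_rev len w2.
exists sg; split=> // [e|tau wt].
  by rewrite esg !walk_edges_cat l1 !mem_cat => ->; rewrite orbT.
have [tau' [wt' lt' _]] := walk_rev len wt.
exists (p1 ++ tau' ++ p3); first exact: walk_cat w1 (walk_cat wt' w3).
have /and3P[_ _ /eqP lt] := wt'.
by rewrite !path_length_cat l1 l2 lt lt' lsg; lra.
Qed.

Definition geodesic s t p :=
  is_path H s t p /\
  forall w, walk H s t w -> path_length len s p <= path_length len s w.

(** For a geodesic [p], this says that every shortest walk from [s] to [t] uses [e]. *)
Definition unavoidable (e : {set V}) s t p :=
  forall w, walk H s t w -> path_length len s w <= path_length len s p ->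
    e \in walk_edges s w.

(* Between two members [a] and [b] of [F], the first geodesic can be rerouted
   along the second one at no cost: this would avoid the edge attached to a
   third member of [F] lying between them. *)
Lemma card_branching_le2 s1 t1 p1 s2 t2 p2 (F : {set V}) :
  geodesic s1 t1 p1 -> geodesic s2 t2 p2 ->
  (forall v, v \in F -> [/\ v \in p1, v \in s2 :: p2 & exists e : {set V},
     [/\ v \in e, e \notin walk_edges s2 p2 & unavoidable e s1 t1 p1]]) ->
  (#|F| <= 2)%N.
Proof.
move=> [path1 min1] [path2 min2] FP; rewrite leqNgt; apply/negP => F3.
have : (2 < size [seq x <- p1 | x \in F])%N.
  apply: leq_trans F3 _; apply: leq_trans (card_size _).
  apply/subset_leq_card/fintype.subsetP => v vF.
  by rewrite mem_filter vF; case: (FP v vF).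
have := filter_subseq (mem F) p1; have := filter_all (mem F) p1.
(* [a], [v], [b] are members of [F] in the order in which [p1] visits them. *)
case: [seq x <- p1 | x \in F] => [|a [|v [|b l]]] //= /and4P[aF vF bF _] + _.
case/subseq_cons_split=> q1 [p1' [Ep1 /subseq_cons_split[q2 [p1'' [Ep1' +]]]]].
case/subseq_cons_split=> q3 [q4 [Ep1'' _]]; subst p1' p1''.
have [_ _ [e [ve ep2 une]]] := FP v vF.
have [_ a2 _] := FP a aF; have [_ b2 _] := FP b bF.
have [sg [wsg esg short]] := walk_segment (is_path_walk path2) a2 b2.
(* As [p1] is simple, its portions before [a] and after [b] miss [v], hence also the edge [e] at
   [v]. *)
have [U1 U2] : v \notin s1 :: rcons q1 a /\ v \notin b :: q4.
  have /and4P[_ _ U _] := path1.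
  have /uniq_mid[v1 v2] :
      uniq ((s1 :: rcons q1 a ++ q2) ++ v :: q3 ++ b :: q4).
    by rewrite cat_cons -catA cat_rcons -Ep1.
  move: v1 v2; rewrite in_cons !mem_cat in_cons !negb_or.
  by move=> /and3P[-> -> _] /andP[_ ->].
have w1 := is_path_walk path1; rewrite Ep1 in w1.
have Eq : q1 ++ a :: q2 ++ v :: q3 ++ b :: q4 =
          rcons q1 a ++ rcons (q2 ++ v :: q3) b ++ q4.
  by rewrite !cat_rcons -catA.
rewrite Eq in w1; case/walk_split: w1 => wq1 /walk_split[wq2 wq3].
rewrite !last_rcons in wq1 wq2 wq3.
(* Minimality of [p2] shows that its piece [sg] is no longer than the portion of [p1] from [a] to
   [b]; so [p1] rerouted along [sg] is still shortest and must use [e]. *)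
have [w ww lw] := short _ wq2; have := min2 _ ww => le2.
have := une (rcons q1 a ++ sg ++ q4) (walk_cat wq1 (walk_cat wsg wq3)).
have /and3P[_ _ /eqP lsg] := wsg.
rewrite {1}Ep1 Eq !path_length_cat !last_rcons lsg => une1.
have {}une1 := une1 ltac:(lra).
move: une1; rewrite !walk_edges_cat !mem_cat last_rcons lsg =>
  /or3P[/mem_walk_edges|/esg|/mem_walk_edges].
- by move/(_ v ve); rewrite (negPf U1).
- by rewrite (negPf ep2).
- by move/(_ v ve); rewrite (negPf U2).
Qed.

(** Each vertex of [N] is charged to a couple of indices; by [card_branching_le2] no couple is
    charged more than twice. *)
Lemma card_branching (I : finType) (P : {set I}) (src tgt : I -> V)
    (pth : I -> seq V) (N : {set V}) :
  (forall i, i \in P -> geodesic (src i) (tgt i) (pth i)) ->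
  (forall v, v \in N -> exists i j, [/\ i \in P, j \in P, v \in pth i,
     v \in src j :: pth j & exists e : {set V}, [/\ v \in e,
       e \notin walk_edges (src j) (pth j) &
       unavoidable e (src i) (tgt i) (pth i)]]) ->
  (#|N| <= 2 * #|P| ^ 2)%N.
Proof.
move=> geo NP.
(* A member of [N] also provides the default couple [(i0, j0)] for the choice function outside
   [N]. *)
have [->|/set0Pn[v0 /NP[i0 [j0 _]]]] := eqVneq N finset.set0;
  first by rewrite cards0.
have /boolp.choice[g gP] : forall v, exists ij : I * I, v \in N ->
    [/\ ij.1 \in P, ij.2 \in P, v \in pth ij.1,
     v \in src ij.2 :: pth ij.2 & exists e : {set V}, [/\ v \in e,
       e \notin walk_edges (src ij.2) (pth ij.2) &
       unavoidable e (src ij.1) (tgt ij.1) (pth ij.1)]].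
  move=> v; case: (boolP (v \in N)) => [/NP[i [j ij]]|vN];
    first by exists (i, j).
  by exists (i0, j0).
rewrite -sum1_card (partition_big g (fun ij => ij \in finset.setX P P)) /=;
  last first.
  by move=> v /gP[gi gj _ _ _]; rewrite inE gi gj.
apply: (@leq_trans (\sum_(ij in finset.setX P P) 2)%N).
  apply: leq_sum => -[i j]; rewrite finset.in_setX => /andP[iP jP].
  rewrite (eq_bigl (fun v => v \in [set v in N | g v == (i, j)])); last first.
    by move=> v; rewrite inE.
  rewrite sum1_card; apply: (card_branching_le2 (geo i iP) (geo j jP)) => v.
  by rewrite inE => /andP[/gP + /eqP gv]; rewrite gv => -[].
by rewrite sum_nat_const finset.cardsX mulnC mulnn.
Qed.

End Geodesics.

(** * Distance-preserving minors *)

Section Minors.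
Variables (V : finType) (T : {set V}) (G : graph V).

Lemma minor_vertices (H : graph V) : minor T G H ->
  vertices H \subset vertices G.
Proof.
elim=> // {}H; first by move=> v _ IH _ _;
  apply: fintype.subset_trans (finset.subsetDl _ _) IH.
move=> u v _ IH uv _; apply/fintype.subsetP => x; rewrite !inE =>
  /predU1P[->|/andP[_]].
  exact/(fintype.subsetP IH)/(@adj_vertex _ _ u v).
exact: fintype.subsetP IH x.
Qed.

Lemma minor_terminals (H : graph V) : T \subset vertices G -> minor T G H ->
  T \subset vertices H.
Proof.
move=> TG; elim=> // {}H; first by move=> v _ IH _ vT; rewrite subsetD1 IH.
move=> u v _ IH uv vT; apply/fintype.subsetP => x xT; rewrite !inE.
rewrite (fintype.subsetP IH x xT) andbT.
by rewrite (_ : x != v) ?orbT //; apply: contraNneq vT => <-.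
Qed.

Lemma adj_contract (H : graph V) u v x y : adj H x y -> x != v -> y != v ->
  adj (Defs.contract H u v) x y.
Proof.
move=> xy xv yv; rewrite /adj inE finset.cards2 (adj_neq xy) andbT.
apply/imsetP; exists [set x; y]%SET => //.
by rewrite imsetU1 imset_set1 /redirect (negPf xv) (negPf yv).
Qed.

Lemma adj_contract_nbr (H : graph V) u v y : adj H v y -> y != u ->
  adj (Defs.contract H u v) u y.
Proof.
move=> vy yu; rewrite /adj inE finset.cards2 [u == y]eq_sym yu andbT.
apply/imsetP; exists [set v; y]%SET => //.
by rewrite imsetU1 imset_set1 /redirect eqxx [y == v]eq_sym (negPf (adj_neq
  vy)).
Qed.

Lemma adj_contractP (H : graph V) u v x y : adj (Defs.contract H u v) x y ->
  exists a b, [/\ adj H a b, x = redirect u v a & y = redirect u v b].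
Proof.
rewrite /adj inE => /andP[/imsetP[e eH]].
have /andP[_ /cards2P[a [b [_ Ee]]]] := forall_inP (edgesP H) e eH.
rewrite Ee imsetU1 imset_set1 => /set2_eq[] [-> ->] _.
  by exists a, b; rewrite /adj -Ee.
by exists b, a; rewrite /adj finset.setUC -Ee.
Qed.

End Minors.

(** * Minors weighted by the distances of the original graph *)

Section MetricMinors.
Variables (R : realType) (V : finType) (G : graph V) (len : {set V} -> R).
Variable T : {set V}.
Hypothesis pos : positive_on_edges G len.
Implicit Types (H : graph V) (s t u v x y : V).

(* Minors keep the names of vertices, so all of them can carry these lengths;
   distances between terminals then never drop below those in [G]. *)
Definition metric_len (e : {set V}) : R :=
  if [pick xy : V * V | e == [set xy.1; xy.2]%SET] is Some xy
  then fine (dist G len xy.1 xy.2) else 0.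

Lemma metric_lenE x y :
  metric_len [set x; y]%SET = fine (dist G len x y).
Proof.
rewrite /metric_len; case: pickP => [[a b] /= /eqP/set2_eq[] [-> ->] //|].
  by rewrite dist_sym.
by move=> /(_ (x, y)); rewrite eqxx.
Qed.

Definition linked x y := (dist G len x y < +oo)%E.

Lemma linked_sym x y : linked x y -> linked y x.
Proof. by rewrite /linked dist_sym. Qed.

Lemma linked_trans y x z : linked x y -> linked y z -> linked x z.
Proof.
move=> xy yz; apply: le_lt_trans (dist_triangle pos x y z) _.
exact: lte_add_pinfty.
Qed.

Lemma linked_refl x : x \in vertices G -> linked x x.
Proof. by move=> xG; rewrite /linked (dist_self pos xG). Qed.

Lemma metric_len_triangle x y z : linked x y -> linked y z ->
  metric_len [set x; z]%SET <=
  metric_len [set x; y]%SET + metric_len [set y; z]%SET.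
Proof.
move=> xy yz; rewrite !metric_lenE -lee_fin EFinD !dist_fineK //.
  exact: dist_triangle.
exact: linked_trans xy yz.
Qed.

(** This ensures that on edges of a minor [metric_len] is a true distance and not the value [0] that
    [fine] gives to [+oo]. *)
Lemma minor_linked H : minor T G H -> forall x y, adj H x y -> linked x y.
Proof.
elim=> {H} [x y xy|H v _ IH _ _ x y|H e _ IH _ x y|H u v _ IH uv _ x y].
- apply: le_lt_trans (ltry (path_length len x [:: y])).
  by apply: dist_le_walk pos _; rewrite /walk (adj_vertex xy) /= xy /=.
- by rewrite /adj inE => /andP[/IH].
- by rewrite /adj inE => /andP[_ /IH].
(* Renaming moves a vertex at most along the contracted edge, whose ends are linked. *)
have redirect_conn a : a \in vertices G -> linked a (redirect u v a).
  rewrite /redirect; case: eqP => [-> _|_]; last exact: linked_refl.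
  exact/linked_sym/IH.
case/adj_contractP=> a [b [/IH ab -> ->]].
have [aG bG] := dist_finite_vertices ab.
apply: (@linked_trans a); first exact/linked_sym/redirect_conn.
by apply: (@linked_trans b) => //; apply: redirect_conn.
Qed.

Lemma metric_len_pos H : minor T G H -> positive_on_edges H metric_len.
Proof.
move=> mH e eH.
have /andP[_ /cards2P[a [b [ab Ee]]]] := forall_inP (edgesP H) e eH.
have cab : linked a b by apply: (minor_linked mH); rewrite /adj -Ee.
by rewrite Ee metric_lenE -lte_fin dist_fineK // dist_gt0.
Qed.

(** Each edge of a path in [H] costs the [G]-distance of its ends, so the triangle inequality in [G]
    bounds the whole path from below. *)
Lemma dist_le_minor H s t : minor T G H ->
  (dist G len s t <= dist H metric_len s t)%E.
Proof.
move=> mH; apply: le_ereal_inf_tmp => _ [p /and4P[sH pP _ /eqP <-] <-] {t}.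
have {sH} : s \in vertices G by apply: fintype.subsetP (minor_vertices mH) _ sH.
elim: p s pP => [|x p IH] s /=.
  by move=> _ sG; rewrite (dist_self pos sG) /path_length big_nil.
move=> /andP[/(minor_linked mH) sx pP] _;
  have [_ xG] := dist_finite_vertices sx.
apply: le_trans (dist_triangle pos s x _) _.
by rewrite path_length_cons EFinD leeD ?IH // metric_lenE dist_fineK.
Qed.

Variable P : {set {set V}}.
Hypothesis PT : forall f, f \in P -> exists s t,
  [/\ s \in T, t \in T, f = [set s; t]%SET & linked s t].

(** Together with [dist_le_minor], the distances of the pairs in [P] are preserved exactly. *)
Definition preserving_minor H :=
  minor T G H /\ forall s t, [set s; t]%SET \in P ->
    (dist H metric_len s t <= dist G len s t)%E.

(** An edge is itself a walk between its ends, so replacing [len] by [metric_len] lengthens no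
    path. *)
Lemma preserving_minor_refl : preserving_minor G.
Proof.
split=> [|s t /PT[s' [t' [_ _ eq st']]]]; first exact: minor_refl.
have {st'} st : linked s t.
  by case/set2_eq: eq st' => -[-> ->] // /linked_sym.
have [p pG ->] := dist_attained st.
have [_ pP _ _] := and4P pG.
apply: le_trans (dist_le_walk (metric_len_pos (minor_refl T G)) (is_path_walk
  pG)) _.
rewrite lee_fin; elim: p s pP {pG st eq} => [|x p IH] s /=.
  by rewrite /path_length !big_nil.
move=> /andP[sx /IH]; rewrite !path_length_cons; apply: lerD.
rewrite metric_lenE -lee_fin dist_fineK //; last first.
  exact: minor_linked (minor_refl T G) _ _ sx.
have : walk G s x [:: x] by rewrite /walk (adj_vertex sx) /= sx /=.
by move/(dist_le_walk pos); rewrite path_length_cons /path_length big_nil addr0.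
Qed.

(** Each of the three minor operations strictly decreases this measure. *)
Definition graph_size H := (#|vertices H| + #|edges H|)%N.

Lemma minimal_preserving_minor : exists2 H, preserving_minor H &
  forall H', preserving_minor H' -> (graph_size H <= graph_size H')%N.
Proof.
have ex : exists n, `[< exists2 H, preserving_minor H & graph_size H = n >].
  by exists (graph_size G); apply/asboolP; exists G => //;
    apply: preserving_minor_refl.
case: (ex_minnP ex) => n /asboolP[H pH <-] min.
by exists H => // H' pH'; apply: min; apply/asboolP; exists H'.
Qed.

(** * Properties of a smallest preserving minor *)

Section Minimal.
Variable H : graph V.
Hypothesis Hpres : preserving_minor H.
Hypothesis Hmin :
  forall H', preserving_minor H' -> (graph_size H <= graph_size H')%N.
Variables (src tgt : {set V} -> V) (pth : {set V} -> seq V).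
Hypothesis ends : forall f, f \in P ->
  [/\ src f \in T, tgt f \in T & f = [set src f; tgt f]%SET].
Hypothesis pth_path : forall f, f \in P -> is_path H (src f) (tgt f) (pth f).
Hypothesis pth_le : forall f, f \in P ->
  ((path_length metric_len (src f) (pth f))%:E <= dist G len (src f) (tgt f))%E.

Lemma preserving_minor_walks H' : minor T G H' ->
  (forall f, f \in P -> exists2 w, walk H' (src f) (tgt f) w &
     path_length metric_len (src f) w <= path_length metric_len (src f) (pth
       f)) ->
  preserving_minor H'.
Proof.
move=> mH' wH'; split=> // s t fP; have [_ _ Ef] := ends fP.
have [w ww lew] := wH' _ fP.
have main : (dist H' metric_len (src [set s; t]%SET) (tgt [set s; t]%SET) <=
             dist G len (src [set s; t]%SET) (tgt [set s; t]%SET))%E.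
  apply: le_trans (dist_le_walk (metric_len_pos mH') ww) _.
  by apply: le_trans (pth_le fP); rewrite lee_fin.
case/set2_eq: Ef main => -[<- <-] //.
by rewrite (dist_sym (metric_len_pos mH')) (dist_sym pos).
Qed.

(** Otherwise all chosen geodesics survive the deletion of [v], against minimality. *)
Lemma minimal_vertex v : v \in vertices H -> v \notin T ->
  exists2 f, f \in P & v \in pth f.
Proof.
move=> vH vT; apply: contrapT => none.
have [mH _] := Hpres.
have mH' := minor_del_vertex mH vH vT.
suff /Hmin : preserving_minor (del_vertex H v).
  apply/negP; rewrite -ltnNge /graph_size /= [X in (_ < X + _)%N](cardsD1 v) vH.
  rewrite addnAC add1n ltnS addnC leq_add2r.
  by apply/subset_leq_card/fintype.subsetP => e; rewrite inE => /andP[].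
apply: preserving_minor_walks => // f fP; exists (pth f) => //.
have [sT tT _] := ends fP; have /and4P[sH pP _ lt] := pth_path fP.
have sv : src f != v by apply: contraNneq vT => <-.
apply/and3P; split; rewrite ?inE ?sv // path_adjE; apply/allP => e ep.
rewrite inE; apply/andP; split; first by move: pP; rewrite path_adjE =>
  /allP ->.
apply/negP => /(mem_walk_edges ep); rewrite inE eq_sym (negPf sv) /= => vp.
by apply: none; exists f.
Qed.

(** Otherwise every pair has a walk that avoids [e] and is no longer than its geodesic, so [e] could
    be deleted. *)
Lemma minimal_edge e : e \in edges H ->
  exists2 f, f \in P & unavoidable H metric_len e (src f) (tgt f) (pth f).
Proof.
move=> eH; apply: contrapT => none.
have [mH _] := Hpres.
have mH' := minor_del_edge mH eH.
suff /Hmin : preserving_minor (del_edge H e).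
  by apply/negP; rewrite -ltnNge /graph_size /= (cardsD1 e (edges H)) eH
    ltn_add2l.
apply: preserving_minor_walks => // f fP; apply: contrapT => avoid; apply: none.
exists f => // w ww lew; apply: contrapT => /negP ew; apply: avoid.
exists w => //; case/and3P: ww => sH pP lt; apply/and3P; split=> //.
rewrite path_adjE; apply/allP => g gw; rewrite !inE.
move: pP; rewrite path_adjE => /allP ->//; rewrite andbT.
by apply: contraNneq ew => <-.
Qed.

(** Otherwise every chosen geodesic through [v] runs along [u v]. Contracting [v] into [u] then
    replaces its two edges at [v] by a single one, no longer by the triangle inequality. *)
Lemma minimal_contraction u v : adj H u v -> v \notin T ->
  exists f, [/\ f \in P, v \in pth f &
    [set u; v]%SET \notin walk_edges (src f) (pth f)].
Proof.
move=> uv vT; apply: contrapT => none.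
have [mH _] := Hpres.
have mH' := minor_contract mH uv vT.
have uH := adj_vertex uv; have vu : adj H v u by rewrite adj_sym.
have vH := adj_vertex vu.
suff /Hmin : preserving_minor (Defs.contract H u v).
  apply/negP; rewrite -ltnNge /graph_size /=.
  (* The name [u] is already present, so exactly one vertex is lost; the edges of the contraction
     are images of edges and do not become more numerous. *)
  have -> : u |: vertices H :\ v = vertices H :\ v.
    by apply/finset.setUidPr; rewrite finset.sub1set !inE uH (adj_neq uv).
  rewrite [X in (_ < X + _)%N](cardsD1 v) vH.
  rewrite -addnA add1n ltnS leq_add2l.
  apply: leq_trans (leq_imset_card (fun e : {set V} =>
    redirect u v @: e) (mem (edges H))).
  by apply/subset_leq_card/fintype.subsetP => e; rewrite inE => /andP[].
have keep p s : path (adj H) s p -> v \notin s :: p ->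
    path (adj (Defs.contract H u v)) s p.
  elim: p s => //= x p IH s /andP[sx xp]; rewrite !inE !negb_or.
  move=> /and3P[vs vx vp]; rewrite adj_contract 1?eq_sym //=.
  by apply: IH; rewrite // inE negb_or vx.
apply: preserving_minor_walks => // f fP.
have [sT tT _] := ends fP; have /and4P[sH pP Up lt] := pth_path fP.
have vs : v != src f by apply: contraNneq vT => ->.
have vt : v != tgt f by apply: contraNneq vT => ->.
have sH' : src f \in vertices (Defs.contract H u v).
  by rewrite /= !inE sH [src f == v]eq_sym vs orbT.
have [vp|vp] := boolP (v \in pth f); last first.
  exists (pth f) => //; apply/and3P; split=> //.
  by apply: keep => //; rewrite in_cons negb_or vs.
have uvp : [set u; v]%SET \in walk_edges (src f) (pth f).
  by apply: contrapT => /negP uvp; apply: none; exists f.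
(* The geodesic ends at a terminal, so [v] has a successor [b] on it. *)
case/splitPr: vp pP Up lt uvp => p1 [|b p2]; rewrite last_cat.
  by rewrite /= (negPf vt).
rewrite cat_path -cat_cons => /andP[P1 /and3P[av vb P2]] U lt uvp.
have [v1 v2] := uniq_mid U.
have bu : b \in b :: p2 by rewrite mem_head.
have a1 : last (src f) p1 \in src f :: p1 by exact: mem_last.
have ab : last (src f) p1 != b.
  have /uniq_mid[b1 _] : uniq (((src f :: p1) ++ [:: v]) ++ b :: p2) by
    rewrite -catA.
  by apply: contraNneq b1 => <-; rewrite mem_cat a1.
have vNb : v != b by apply: contraNneq v2 => ->.
have aNv : last (src f) p1 != v by rewrite (adj_neq av).
(* The path being simple, only its edges just before and just after [v] contain [v]. *)
have uab : u = last (src f) p1 \/ u = b.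
  move: uvp; rewrite walk_edges_cat mem_cat /= !inE => /or4P[|/eqP|/eqP|].
  - by move=> /mem_walk_edges/(_ (finset.set22 u v)); rewrite (negPf v1).
  - by case/set2_eq=> -[-> E]; [left | left; rewrite -E].
  - by case/set2_eq=> -[E1 E2]; right; rewrite // E1 E2.
  - by move=> /mem_walk_edges/(_ (finset.set22 u v)); rewrite (negPf v2).
exists (p1 ++ b :: p2); last first.
  rewrite !path_length_cat !path_length_cons lerD2l addrA lerD2r.
  by apply: metric_len_triangle; apply: (minor_linked mH).
apply/and3P; split=> //; last by rewrite last_cat.
rewrite cat_path keep //= keep // andbT.
case: uab => [ua|ub].
  by rewrite -ua; apply: adj_contract_nbr; rewrite // ua eq_sym.
by rewrite adj_sym -ub; apply: adj_contract_nbr; rewrite 1?adj_sym // ub.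
Qed.

End Minimal.

Lemma preserving_minor_few_nonterminals :
  exists2 H, preserving_minor H & (#|vertices H :\: T| <= 2 * #|P| ^ 2)%N.
Proof.
have [H pH Hmin] := minimal_preserving_minor; exists H => //.
have [mH dH] := pH.
have [->|[v0 _]] := set_0Vmem (vertices H :\: T); first by rewrite cards0.
(* For each pair, [D] fixes an orientation and a shortest path in [H]; [v0] only fills in values
   outside [P]. *)
have /boolp.choice[D DP] : forall f : {set V}, exists D : V * V * seq V, f \in
  P ->
    [/\ D.1.1 \in T, D.1.2 \in T, f = [set D.1.1; D.1.2]%SET,
        is_path H D.1.1 D.1.2 D.2 &
        dist H metric_len D.1.1 D.1.2 = (path_length metric_len D.1.1 D.2)%:E].
  move=> f; case: (pselect (f \in P)) => [fP|nfP]; last first.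
    by exists (v0, v0, [::]).
  have [s [t [sT tT Ef st]]] := PT fP.
  have [|p pP dp] := @dist_attained R V H metric_len s t.
    by apply: le_lt_trans st; apply: dH; rewrite -Ef.
  by exists (s, t, p).
pose src f := (D f).1.1; pose tgt f := (D f).1.2; pose pth f := (D f).2.
have ends f : f \in P -> [/\ src f \in T, tgt f \in T & f = [set src f;
  tgt f]%SET].
  by case/DP.
have paths f : f \in P -> is_path H (src f) (tgt f) (pth f) by case/DP.
have le f : f \in P ->
  ((path_length metric_len (src f) (pth f))%:E <= dist G len (src f) (tgt f))%E.
  by move=> fP; case/DP: (fP) => _ _ Ef _ <-; apply: dH; rewrite -Ef.
have mpos := metric_len_pos mH.
apply: (card_branching (len := metric_len) (src := src) (tgt := tgt) (pth :=
  pth)) => [f fP|v].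
  split=> [|w ww]; first exact: paths.
  by rewrite -lee_fin; case/DP: fP => _ _ _ _ <-; apply: dist_le_walk.
rewrite inE => /andP[vT vH].
have [f0 f0P] := minimal_vertex pH Hmin ends paths le vH vT.
move=> vp; have f0path := paths f0 f0P; have [sT _ _] := ends f0 f0P.
(* The neighbour is the predecessor of [v] on the geodesic of [f0]. *)
have [a av] : exists a, adj H a v.
  case/splitPr: vp f0path => p1 p2 /and4P[_ + _ _].
  by rewrite cat_path /= => /and3P[_ av _]; exists (last (src f0) p1).
have [f1 f1P un] := minimal_edge pH Hmin ends le av.
have [f2 [f2P vp2 e2]] := minimal_contraction pH Hmin ends paths le av vT.
exists f1, f2; split=> //; last 1 first.
- by exists [set a; v]%SET; split=> //; rewrite !inE eqxx orbT.
(* The unavoidable edge lies on the geodesic of [f1] itself, and [v] is not its source, which is a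
   terminal. *)
- have := mem_walk_edges (un _ (is_path_walk (paths f1 f1P)) (lexx _))
    (finset.set22 a v).
  rewrite inE => /predU1P[vs|//].
  by have [] := ends f1 f1P; rewrite -vs (negPf vT).
- by rewrite inE vp2 orbT.
Qed.

End MetricMinors.

(** * The size bound *)

(** For positive [k], take for [d] the integer part of [x], the [q]-th root of [k], plus one: it
    exceeds [x], and [d <= 2 x] because [x >= 1]. Squaring gives the constant [2 * 4]. *)
Lemma root_bound (R : realType) (k q : nat) : (0 < q)%N ->
  exists d, (k < d ^ q)%N /\
    (2 * (d * k) ^ 2)%:R <= 8 * k%:R `^ (2 + 2 / q%:R) :> R.
Proof.
move=> q0; have [->|k0] := posnP k.
  by exists 1%N; rewrite exp1n muln0 exp0n // muln0 mulr_ge0 // powR_ge0.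
have kR : 1 <= k%:R :> R by rewrite ler1n.
pose x : R := k%:R `^ q%:R^-1.
have xq : x ^+ q = k%:R.
  by rewrite -powR_mulrn ?powR_ge0 // -powRrM mulVf ?powRr1 // pnatr_eq0 -lt0n.
have x1 : 1 <= x by rewrite -[1](powRr0 k%:R) ler_powR.
have x0 : 0 <= x by apply: le_trans x1.
exists (Num.trunc x).+1; split.
  rewrite -(ltr_nat R) natrX -xq ltrXn2r ?gtn_eqF //.
  exact: truncnS_gt.
have dx : (Num.trunc x).+1%:R <= 2 * x.
  rewrite -natr1; have : (Num.trunc x)%:R <= x by rewrite truncn_le.
  by lra.
have -> : k%:R `^ (2 + 2 / q%:R) = (x * k%:R) ^+ 2.
  rewrite powRD; last by rewrite pnatr_eq0 (gtn_eqF k0) implybT.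
  rewrite [2 / _]mulrC powRrM !powR_mulrn ?powR_ge0 ?ler0n //.
  by rewrite exprMn mulrC.
rewrite natrM natrX natrM -[8]/(2 * 4)%:R natrM -mulrA ler_pM2l //.
have -> : 4 * (x * k%:R) ^+ 2 = (2 * x * k%:R) ^+ 2 by rewrite !exprMn; ring.
by rewrite lerXn2r ?nnegrE ?mulr_ge0 // ler_wpM2r.
Qed.

Lemma dist_hop_ball (R : realType) (V : finType) (H : graph V)
    (len : {set V} -> R) (r : rel V) (W : R) s t n :
  positive_on_edges H len -> s \in vertices H ->
  (forall x y, r x y -> (dist H len x y <= W%:E)%E) -> 0 <= W ->
  t \in hop_ball r s n -> (dist H len s t <= (n%:R * W)%:E)%E.
Proof.
move=> pos sH rW W0; elim: n t => [|n IH] t.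
  by rewrite inE mul0r => /eqP->; rewrite dist_self.
rewrite -natr1 mulrDl mul1r => /hop_ballSP[/IH le|[y /IH le /rW le2]].
  by apply: le_trans le _; rewrite lee_fin lerDl.
by apply: le_trans (dist_triangle pos s y t) _; rewrite EFinD leeD.
Qed.

Theorem theorem4p5 (R : realType) :
  exists C : R,
    forall (q : nat) (V : finType) (G : graph V) (len : {set V} -> R)
      (T : {set V}) (k : nat),
      (1 <= q)%N ->
      positive_on_edges G len ->
      T \subset vertices G ->
      #|T| = k ->
      exists (H : graph V) (len' : {set V} -> R),
        is_DAM_size T G len (2 * q%:R - 1) (C * k%:R `^ (2 + 2 / q%:R)) H len'.
Proof.
exists 8 => q V G len T k q0 pos TG Tk.
pose w x y := fine (dist G len x y).
pose leT (a b : V * V) := w a.1 a.2 <= w b.1 b.2.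
(* Pairs at infinite distance are left out, since [w] would give them weight [0]. *)
pose l := sort leT [seq a <- enum (finset.setX T T) |
  (a.1 != a.2) && linked G len a.1 a.2].
have memlP x y : ((x, y) \in l) =
    [&& x != y, linked G len x y, x \in T & y \in T].
  by rewrite mem_sort mem_filter /= mem_enum finset.in_setX -andbA.
have wC x y : w x y = w y x by rewrite /w dist_sym.
have leT_l : pairwise leT l.
  rewrite -sorted_pairwise; last by move=> a b c; apply: le_trans.
  by apply: sort_sorted => a b; apply: le_total.
have [E [El hf span]] := greedy_spanner q0 wC leT_l.
have ET f : f \in E -> exists s t,
    [/\ s \in T, t \in T, f = [set s; t]%SET & linked G len s t].
  by case/El=> -[s t]; rewrite memlP => /and4P[_ ? ? ?]; exists s, t.
have wfE : wf_edges T E.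
  apply/forall_inP => f /El[[s t]]; rewrite memlP => /and4P[st _ sT tT] ->.
  by rewrite finset.cards2 st finset.subUset !finset.sub1set sT tT.
have [H [mH dH] few] := preserving_minor_few_nonterminals pos ET.
have posH := metric_len_pos pos mH.
exists H, (metric_len G len); split.
  split=> // t t' tT t'T; split; first exact: (dist_le_minor pos t t' mH).
  have q1 : 0 < 2 * q%:R - 1 :> R by have : 1 <= q%:R :> R by [rewrite
    ler1n|]; lra.
  have tH := fintype.subsetP (minor_terminals TG mH) t tT.
  have [<-|tt'] := eqVneq t t'.
    by rewrite dist_self // mule_ge0 ?dist_ge0 // lee_fin ltW.
  (* For unlinked terminals the upper bound is [+oo], the factor [2 q - 1] being positive. *)
  have [ctt|] := boolP (linked G len t t'); last first.
    by rewrite /linked -leNgt leye_eq => /eqP->;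
      rewrite gt0_muley ?leey ?lte_fin.
  have ltt : (t, t') \in l by rewrite memlP tt' ctt tT t'T.
  have W0 : 0 <= w t t' by rewrite fine_ge0 // dist_ge0.
  have short x y : edge_rel E x y && (w x y <= w t t') ->
      (dist H (metric_len G len) x y <= (w t t')%:E)%E.
    case/andP=> xyE le; apply: le_trans (dH _ _ xyE) _.
    have cxy : linked G len x y.
      have [s [s' [_ _ /set2_eq[] [-> ->]]]] := ET _ xyE => //.
      exact: linked_sym.
    by rewrite -dist_fineK // lee_fin.
  have := dist_hop_ball posH tH short W0 (span _ ltt).
  (* The spanner provides [2 q - 1] hops, each costing at most [w t t'] in [H]. *)
  rewrite -subn1 natrB ?muln_gt0 // natrM /w EFinM dist_fineK //.
have [d [kd bound]] := root_bound R k q0.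
apply: le_trans bound; rewrite ler_nat; apply: leq_trans few _.
(* It remains to see that the spanner has at most [d * k] edges. *)
rewrite leq_mul2l /= leq_sqr -Tk.
by apply: hop_free_card_edges wfE hf _; rewrite Tk.
Qed.
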